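(* Any finite-dimensional Lie algebra is the sum of a modular Lie algebra and a unimodular one compatible with it.
   Context: Lie algebras are over a ground field $\mathbf k$. Two Lie algebra structures $[\cdot,\cdot]_1$ and $[\cdot,\cdot]_2$ on the same vector space $V$ are compatible if $[\cdot,\cdot]_1+[\cdot,\cdot]_2$ is a Lie bracket on $V$; the Lie algebra structure defined by this bracket is called the sum of the two structures. A Lie algebra $\mathfrak g$ is unimodular if $\operatorname{tr}(\operatorname{ad}u)=0$ for all $u\in\mathfrak g$. A modular Lie algebra is one of the form $W_0\oplus W_1$ (direct sum of vector spaces) with $\dim W_1=1$, $0\neq e\in W_1$, and bracket given by $[u,v]=0$ for $u,v\in W_0$ and $[u,e]=A_0(u)$ for $u\in W_0$, where $A_0:W_0\to W_0$ is a linear operator with $\operatorname{tr}A_0\neq 0$.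
   Formalization: A unimodular Lie algebra is never the sum of a modular and a unimodular one, since traces of ad add and the modular one has a nonzero trace; so for a unimodular Lie algebra the modular summand is taken to be zero, and for every other Lie algebra it is genuinely modular. *)

(* Defs.v *)
From HB Require Import structures.
From mathcomp Require Import all_boot all_order all_algebra.

Set Implicit Arguments.
Unset Strict Implicit.
Unset Printing Implicit Defensive.

Import GRing.Theory.
Local Open Scope ring_scope.

Definition lf_trace (K : fieldType) (V : vectType K) (f : 'End(V)) : K :=
  \tr (passmx.mxof (vbasis {:V}) (vbasis {:V}) f).

(* A bilinear map V x V -> V is encoded as a linear map b : V -> 'End(V), so
   that b u v is the bracket of u and v, b u is ad u, and the sum of two
   brackets is their sum in 'Hom(V, 'End(V)).  The condition b u u = 0 (and not
   merely antisymmetry) is required, so that characteristic 2 is covered. *)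
Definition is_lie (K : fieldType) (V : vectType K) (b : 'Hom(V, 'End(V))) :
    Prop :=
  (forall u, b u u = 0) /\
  (forall u v w, b u (b v w) + b v (b w u) + b w (b u v) = 0).

Definition compatible (K : fieldType) (V : vectType K)
    (b1 b2 : 'Hom(V, 'End(V))) : Prop :=
  [/\ is_lie b1, is_lie b2 & is_lie (b1 + b2)].

Definition unimodular_lie (K : fieldType) (V : vectType K)
    (b : 'Hom(V, 'End(V))) : Prop :=
  is_lie b /\ forall u, lf_trace (b u) = 0.

Definition modular_lie (K : fieldType) (V : vectType K)
    (b : 'Hom(V, 'End(V))) : Prop :=
  is_lie b /\
  exists (W0 W1 : {vspace V}) (e : V) (A0 : 'End(subvs_of W0)),
    [/\ (W0 + W1)%VS = fullv /\ directv (W0 + W1),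
        \dim W1 = 1%N /\ (e \in W1 /\ e != 0),
        forall u v, u \in W0 -> v \in W0 -> b u v = 0,
        forall u : subvs_of W0, b (vsval u) e = vsval (A0 u)
      & lf_trace A0 != 0].

(* Pitfall: in a modular Lie algebra tr (ad e) = - tr A0 is nonzero, and traces
   add up in a sum of brackets, so the sum of a modular and a unimodular
   structure is never unimodular.  The modular summand of a unimodular Lie
   algebra b therefore has to be absent, i.e. b1 = 0; this is permitted in that
   case only, and otherwise b1 is a genuine modular structure. *)
Definition modular_summand (K : fieldType) (V : vectType K)
    (b b1 : 'Hom(V, 'End(V))) : Prop :=
  modular_lie b1 \/ (unimodular_lie b /\ b1 = 0).

(* Main.v *)
Require Import Defs.
From mathcomp Require Import all_boot all_order all_algebra.
From HB Require Import structures.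
Import GRing.Theory passmx.
Local Open Scope ring_scope.

(** If every [ad u] is traceless, [0 + b] is a decomposition.  Otherwise let
    [l u = tr (ad u)] be the modular character.  Since [ad] of a bracket is a
    commutator, [l] vanishes on all brackets, so its kernel [W0] is an ideal of
    codimension one.  Choose [e] with [l e = 1].  The algebra is then the
    semidirect product of [W0] and the line through [e], and its bracket splits
    into
    - the part in which only [e] acts: [W0] becomes abelian and the bracket of
      [u] in [W0] with [e] is the old one.  This is modular: [A0] is the
      restriction of [- ad e] to [W0], and its trace is [- l e = -1];
    - the part in which only [W0] acts: the direct product of the Lie algebra
      [W0] with an abelian line.  This is unimodular because [l] vanishes
      on [W0].

    With the projection [p u = u - l u *: e] onto [W0] along [e], the second part
    is [b (p u) (p v)] ([pullback]), and with [D = - ad e] the first part is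
    [l v *: D u - l u *: D v].  The Jacobi identity holds for the second because
    [p] fixes every bracket ([pullback_lie]), and for the first because [l]
    kills the image of [D] ([line_action_lie]).  The traces are computed by
    moving a projection onto [W0] cyclically around a composite
    ([pullback_trace], [lf_trace_sub]). *)

(** * Traces of endomorphisms *)

Lemma lf_traceD {K : fieldType} {V : vectType K} (f g : 'End(V)) :
  lf_trace (f + g) = lf_trace f + lf_trace g.
Proof. by rewrite /lf_trace linearD mxtraceD. Qed.

Lemma lf_traceZ {K : fieldType} {V : vectType K} a (f : 'End(V)) :
  lf_trace (a *: f) = a * lf_trace f.
Proof. by rewrite /lf_trace linearZ mxtraceZ. Qed.

Lemma lf_traceN {K : fieldType} {V : vectType K} (f : 'End(V)) :
  lf_trace (- f) = - lf_trace f.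
Proof. by rewrite -scaleN1r lf_traceZ mulN1r. Qed.

Lemma lf_trace_mulC {K : fieldType} {U V : vectType K}
    (f : 'Hom(U, V)) (g : 'Hom(V, U)) :
  lf_trace (f \o g)%VF = lf_trace (g \o f)%VF.
Proof.
rewrite /lf_trace.
rewrite (mxof_comp _ _ (vbasisP {:U})) (mxof_comp _ _ (vbasisP {:V})).
exact: mxtrace_mulC.
Qed.

(** [g] is the inclusion of [W], then [f], then a projection onto [W].  Moving
    the projection and then [f] cyclically leaves [f] followed by the
    projection, which is the identity on the image of [f]. *)
Lemma lf_trace_sub {K : fieldType} {V : vectType K} (W : {vspace V})
    (f : 'End(V)) (g : 'End(subvs_of W)) :
    (forall v, f v \in W) -> (forall u : subvs_of W, vsval (g u) = f (vsval u)) ->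
  lf_trace g = lf_trace f.
Proof.
move=> fW gf; pose i : 'Hom(subvs_of W, V) := linfun vsval.
pose q : 'Hom(V, subvs_of W) := linfun (vsproj W).
have -> : g = (q \o (f \o i))%VF.
  apply/lfunP=> u; rewrite !comp_lfunE !lfunE /=.
  by apply: val_inj; rewrite /= vsprojK ?gf.
rewrite lf_trace_mulC -comp_lfunA lf_trace_mulC; congr lf_trace.
by apply/lfunP=> u; rewrite !comp_lfunE !lfunE /= vsprojK.
Qed.

(** * The modular character *)

Definition ad_trace {K : fieldType} {V : vectType K} (b : 'Hom(V, 'End(V)))
  (u : V) : K^o := lf_trace (b u).

Lemma ad_trace_linear {K : fieldType} {V : vectType K} (b : 'Hom(V, 'End(V))) :
  linear (ad_trace b).
Proof. by move=> a u v; rewrite /ad_trace linearP lf_traceD lf_traceZ. Qed.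

HB.instance Definition _ (K : fieldType) (V : vectType K)
    (b : 'Hom(V, 'End(V))) :=
  GRing.isSemilinear.Build K V K^o _ (ad_trace b)
    (GRing.semilinear_linear (ad_trace_linear b)).

Lemma lie_anti {K : fieldType} {V : vectType K} (b : 'Hom(V, 'End(V))) :
  is_lie b -> forall u v, b u v = - b v u.
Proof.
case=> b0 _ u v; apply/eqP; rewrite -addr_eq0; apply/eqP.
have := b0 (u + v); rewrite linearD /= [b (u + v)]linearD !add_lfunE !b0.
by rewrite add0r addr0 addrC.
Qed.

(** The Jacobi identity makes [ad [u, v]] the commutator of [ad u] and
    [ad v]. *)
Lemma ad_trace_bracket {K : fieldType} {V : vectType K} (b : 'Hom(V, 'End(V))) :
  is_lie b -> forall u v, ad_trace b (b u v) = 0.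
Proof.
move=> hb u v; rewrite /ad_trace.
have -> : b (b u v) = ((b u \o b v) - (b v \o b u))%VF.
  apply/lfunP=> w; rewrite add_lfunE opp_lfunE !comp_lfunE.
  have := hb.2 u v w; rewrite (lie_anti _ hb w (b u v)) (lie_anti _ hb w u).
  by rewrite linearN /= => /eqP; rewrite subr_eq0 => /eqP ->.
by rewrite lf_traceD lf_traceN lf_trace_mulC subrr.
Qed.

(** * The unimodular summand *)

Lemma pullback_linear {K : fieldType} {V : vectType K} (b : 'Hom(V, 'End(V)))
    (p : 'End(V)) :
  linear (fun u => (b (p u) \o p)%VF).
Proof. by move=> a u v; rewrite !linearP /= comp_lfunDl -comp_lfunZl. Qed.

Definition pullback {K : fieldType} {V : vectType K} (b : 'Hom(V, 'End(V)))
    (p : 'End(V)) : 'Hom(V, 'End(V)) :=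
  linfun (HB.pack_for {linear V -> 'End(V)} (fun u => (b (p u) \o p)%VF)
    (GRing.isLinear.Build K V 'End(V) _ _ (pullback_linear b p))).

Lemma pullbackE {K : fieldType} {V : vectType K} (b : 'Hom(V, 'End(V)))
    (p : 'End(V)) u v :
  pullback b p u v = b (p u) (p v).
Proof. by rewrite lfunE /= comp_lfunE. Qed.

Lemma pullback_lie {K : fieldType} {V : vectType K} (b : 'Hom(V, 'End(V)))
    (p : 'End(V)) :
    is_lie b -> (forall u v, p (b u v) = b u v) ->
  is_lie (pullback b p).
Proof.
case=> b0 bJ pb; split=> [u|u v w]; first by rewrite pullbackE b0.
by rewrite !pullbackE !pb bJ.
Qed.

(** Moving [p] around the trace reduces it to that of [b (p u)], since [p] fixes
    every bracket. *)
Lemma pullback_trace {K : fieldType} {V : vectType K} (b : 'Hom(V, 'End(V)))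
    (p : 'End(V)) :
    (forall u v, p (b u v) = b u v) ->
  forall u, lf_trace (pullback b p u) = ad_trace b (p u).
Proof.
move=> pb u; have -> : pullback b p u = (b (p u) \o p)%VF.
  by apply/lfunP=> v; rewrite pullbackE comp_lfunE.
rewrite lf_trace_mulC /ad_trace; congr lf_trace.
by apply/lfunP=> v; rewrite comp_lfunE pb.
Qed.

(** * The modular summand *)

(** [l] vanishes on the values of [c], so each double bracket has just two
    terms; these carry [D (D x)] for one of the three arguments [x], weighted by
    [l] at the other two, and they cancel in the cyclic sum. *)
Lemma line_action_lie {K : fieldType} {V : vectType K} (l : 'Hom(V, K^o))
    (D : 'End(V)) (c : 'Hom(V, 'End(V))) :
    (forall u, l (D u) = 0) ->
    (forall u v, c u v = l v *: D u - l u *: D v) ->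
  is_lie c.
Proof.
move=> lD cE; split=> [u|u v w]; first by rewrite cE subrr.
have lc y z : l (c y z) = 0.
  by rewrite cE linearB !linearZ /= !lD oppr0 !scaler0 addr0.
have cc x y z : c x (c y z) = (l x * l y) *: D (D z) - (l x * l z) *: D (D y).
  rewrite [LHS]cE lc scale0r sub0r cE linearB !linearZ /=.
  by rewrite !scalerN scalerBr !scalerA opprB.
rewrite !cc (mulrC (l v) (l u)) (mulrC (l w) (l u)) (mulrC (l w) (l v)).
by rewrite -addrA [X in _ + X]addrC !subrKA subrr.
Qed.

(** Here [W0] is the kernel of [l] and [W1] the line through [e].  The operator
    [A0] is [D] restricted to [W0], which has the trace of [D] itself because
    [W0] contains the image of [D]. *)
Lemma line_action_modular {K : fieldType} {V : vectType K} (l : 'Hom(V, K^o))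
    (D : 'End(V)) (c : 'Hom(V, 'End(V))) (e : V) :
    (forall u, l (D u) = 0) ->
    (forall u v, c u v = l v *: D u - l u *: D v) ->
    l e = 1 -> lf_trace D != 0 ->
  modular_lie c.
Proof.
move=> lD cE le trD; split; first exact: line_action_lie lD cE.
have DW u : D u \in lker l by rewrite memv_ker lD.
pose A0 : 'End(subvs_of (lker l)) := linfun (vsproj (lker l) \o D \o vsval).
have A0E (u : subvs_of (lker l)) : vsval (A0 u) = D (vsval u).
  by rewrite lfunE /= vsprojK.
have e0 : e != 0.
  by apply: contra_eq_neq le => ->; rewrite linear0 eq_sym oner_neq0.
exists (lker l), <[e]>%VS, e, A0; split.
- split.
    apply/eqP; rewrite eqEsubv subvf; apply/subvP=> u _.
    rewrite -[u](subrK (l u *: e)) memv_add ?memvZ ?memv_line // memv_ker.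
    by rewrite linearB linearZ /= le -[_ *: _]/(_ * _) mulr1 subrr.
  apply/directv_addP/eqP; rewrite -subv0; apply/subvP=> u; rewrite memv_cap.
  case/andP=> lu /vlineP[k uE]; move: lu; rewrite uE memv_ker linearZ /= le.
  by rewrite -[_ *: _]/(_ * _) mulr1 => /eqP->; rewrite scale0r mem0v.
- by rewrite dim_vline e0 memv_line.
- by move=> u v; rewrite !memv_ker cE => /eqP-> /eqP->; rewrite !scale0r subrr.
- move=> u; rewrite A0E cE le scale1r; have := subvsP u.
  by rewrite memv_ker => /eqP->; rewrite scale0r subr0.
- by rewrite (lf_trace_sub _ D A0).
Qed.

(** * The decomposition *)

Lemma zero_lie {K : fieldType} {V : vectType K} :
  is_lie (0 : 'Hom(V, 'End(V))).
Proof. by split=> *; rewrite !zero_lfunE ?addr0. Qed.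

Lemma proj_linear {K : fieldType} {V : vectType K} (l : 'Hom(V, K^o)) (e : V) :
  linear (fun u => u - l u *: e).
Proof.
move=> a u v; rewrite [l _]linearP scalerDl scalerBr /= -[a *: l u]/(a * l u).
by rewrite -[_ *: e]scalerA opprD addrACA.
Qed.

(** When [l e = 1], this is the projection onto the kernel of [l] along [e]. *)
Definition proj_along {K : fieldType} {V : vectType K} (l : 'Hom(V, K^o))
    (e : V) : 'End(V) :=
  linfun (HB.pack_for {linear V -> V} (fun u => u - l u *: e)
    (GRing.isLinear.Build K V V _ _ (proj_linear l e))).

Lemma proj_alongE {K : fieldType} {V : vectType K} (l : 'Hom(V, K^o)) (e u : V) :
  proj_along l e u = u - l u *: e.
Proof. by rewrite lfunE. Qed.

Lemma lie_shift {K : fieldType} {V : vectType K} (b : 'Hom(V, 'End(V))) :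
    is_lie b ->
  forall e u v x y,
    b (u - x *: e) (v - y *: e) = b u v - y *: b u e + x *: b v e.
Proof.
move=> hb e u v x y.
have -> : b (u - x *: e) = b u - x *: b e by rewrite linearB linearZ.
have bB t : b t (v - y *: e) = b t v - y *: b t e by rewrite linearB linearZ.
rewrite add_lfunE opp_lfunE scale_lfunE !bB hb.1 scaler0 subr0.
by rewrite (lie_anti _ hb e v) scalerN opprK.
Qed.

Theorem proposition4p2 (K : fieldType) (V : vectType K)
    (b : 'Hom(V, 'End(V))) (hb : is_lie b) :
  exists b1 b2 : 'Hom(V, 'End(V)),
    [/\ modular_summand b b1,
        unimodular_lie b2,
        compatible b1 b2
      & b = b1 + b2].
Proof.
pose l : 'Hom(V, K^o) := linfun (ad_trace b).
have lE u : l u = lf_trace (b u) by rewrite lfunE.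
have lb u v : l (b u v) = 0 by rewrite lfunE /= ad_trace_bracket.
have [/subvP l0 | /subvPn[x _]] := boolP (fullv <= lker l)%VS.
  have ub : unimodular_lie b.
    by split=> // u; rewrite -lE; apply/eqP; rewrite -(memv_ker l) l0 ?memvf.
  exists 0, b; rewrite /compatible add0r; split=> //; first by right.
  by split=> //; exact: zero_lie.
rewrite memv_ker => lx.
have [e le] : exists e, l e = 1.
  by exists ((l x)^-1 *: x); rewrite linearZ /= -[_ *: _]/(_ * _) mulVf.
pose p := proj_along l e.
have lp u : l (p u) = 0.
  by rewrite proj_alongE linearB linearZ /= le -[_ *: _]/(_ * _) mulr1 subrr.
have pb u v : p (b u v) = b u v by rewrite proj_alongE lb scale0r subr0.
pose b2 := pullback b p; pose b1 := b - b2.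
pose D : 'End(V) := - b e.
have DE u : D u = b u e by rewrite opp_lfunE (lie_anti _ hb u).
have b1E u v : b1 u v = l v *: D u - l u *: D v.
  rewrite /b1 2!(add_lfunE, opp_lfunE) 2!(add_lfunE, opp_lfunE) pullbackE.
  rewrite !proj_alongE (lie_shift _ hb) !DE.
  by rewrite opprD opprB addrA [b u v + _]addrC subrK.
have lD u : l (D u) = 0 by rewrite DE.
have bD : b1 + b2 = b by rewrite subrK.
have lie2 : is_lie b2 by exact: pullback_lie.
exists b1, b2; split=> //.
- left; apply: (line_action_modular _ _ _ _ lD b1E le).
  by rewrite lf_traceN -lE le oppr_eq0 oner_neq0.
- by split=> // u; rewrite pullback_trace // /ad_trace -lE lp.
- by rewrite /compatible bD; split=> //; exact: line_action_lie lD b1E.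
Qed.
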